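(* Let $X$ be a cell complex such that each $1$-cell of $X$ is adjacent to finitely many $2$-cells. Then the $1$-skeleton of $X$ is a fine graph if either of the following holds: (1) $FV_{X,\mathbb{Z}}(k)<\infty$ for every integer $k$; or (2) $X$ is simply-connected, there is a bound on the length of the attaching maps of $2$-cells of $X$, and there is a constant $C\ge 0$ such that $FV_{X,\mathbb{Q}}(k)\le Ck$ for every $k$.
   Context: All complexes are combinatorial cell complexes in the sense of Bridson--Haefliger (Chapter I.8, Appendix): attaching maps of cells are combinatorial maps (i.e. continuous maps restricting to homeomorphisms from open cells onto open cells) for a suitable cell structure on the sphere; in particular each $2$-cell is attached along a closed edge path, whose combinatorial length is the length of the attaching map. A $1$-cell is adjacent to a $2$-cell if it occurs in the boundary path of the $2$-cell. A graph is a $1$-dimensional combinatorial complex (loops and multiple edges allowed). A circuit is a simple closed combinatorial path. A graph $\Gamma$ is fine if for every edge $e$ and each integer $L>0$, the number of circuits of length at most $L$ which contain $e$ is finite. Let $\mathbb{K}$ be $\mathbb{Z}$ or $\mathbb{Q}$. For a complex $X$, an orientation is fixed for each cell of positive dimension, so the cellular chain group $C_i(X,\mathbb{K})$ is the free $\mathbb{K}$-module on the $i$-cells; $\|\cdot\|_1$ is the $\ell_1$-norm in this basis, and $Z_1(X,\mathbb{Z})$ is the group of integral cellular $1$-cycles. For $\gamma\in Z_1(X,\mathbb{Z})$ set $\|\gamma\|_{\partial,\mathbb{K}}=\inf\{\|\mu\|_1:\mu\in C_2(X,\mathbb{K}),\ \partial\mu=\gamma\}$, with $\inf\emptyset=\infty$.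 The homological Dehn function of $X$ over $\mathbb{K}$ is $FV_{X,\mathbb{K}}(k)=\sup\{\|\gamma\|_{\partial,\mathbb{K}}:\gamma\in Z_1(X,\mathbb{Z}),\ \|\gamma\|_1\le k\}$ for $k\in\mathbb{N}$, with $\sup\emptyset=0$; infimum and supremum are taken in $[0,\infty]$. *)

(* Defs.v *)
From HB Require Import structures.
From mathcomp Require Import all_boot all_order all_algebra finmap.
From mathcomp Require Import all_classical all_reals all_analysis.
From mathcomp.multinomials Require Export freeg.

Set Implicit Arguments.
Unset Strict Implicit.
Unset Printing Implicit Defensive.

Import Order.TTheory GRing.Theory Num.Theory.
Import numFieldNormedType.Exports.

Local Open Scope classical_set_scope.
Local Open Scope ring_scope.

(** * Graphs *)

Record graph := Graph {
  vertex : choiceType;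
  edge : choiceType;
  src : edge -> vertex;
  tgt : edge -> vertex
}.

Section Graphs.
Variable G : graph.

(* (e, true) is e traversed from src e to tgt e, (e, false) its reverse. *)
Definition dart := (edge G * bool)%type.

Definition dstart (d : dart) := if d.2 then src d.1 else tgt d.1.
Definition dend (d : dart) := if d.2 then tgt d.1 else src d.1.

Definition closed_path (p : seq dart) :=
  (p != [::]) && cycle (fun d d' => dend d == dstart d') p.

(* Simple: no repeated vertex; no repeated edge excludes the backtracking
   path e e^-1, and is automatic for all other vertex-simple closed paths. *)
Definition circuit (p : seq dart) :=
  [&& closed_path p, uniq (map dstart p) & uniq (map fst p)].

Definition fine_graph :=
  forall (e : edge G) (L : nat), (0 < L)%N ->
    finite_set [set p : seq dart |
      [/\ circuit p, e \in map fst p & (size p <= L)%N]].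

End Graphs.

(** * Combinatorial cell complexes *)

Section Complexes.
Variable R : realType.

Definition sqnorm n (x : 'rV[R]_n) : R := \sum_i x ord0 i ^+ 2.
Definition disc n := [set x : 'rV[R]_n | sqnorm x <= 1].
Definition open_disc n := [set x : 'rV[R]_n | sqnorm x < 1].
Definition sphere n := [set x : 'rV[R]_n | sqnorm x = 1].

(* Values of the characteristic maps outside the closed disc are junk. *)
Record cell_structure (T : topologicalType) := CellStructure {
  cell : nat -> choiceType;
  chr : forall n, cell n -> 'rV[R]_n -> T
}.

Definition open_cell (T : topologicalType) (S : cell_structure T) n
    (c : cell S n) : set T :=
  chr c @` @open_disc n.

(* S is a CW structure on the subspace A: the open cells partition A, and A
   carries the final topology for the characteristic maps. *)
Record cw_structure (T : topologicalType) (A : set T) (S : cell_structure T) :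
    Prop := CWStructure {
  chr_continuous : forall n (c : cell S n), {within @disc n, continuous (chr c)};
  chr_sub : forall n (c : cell S n), chr c @` @disc n `<=` A;
  cell_partition : forall x, A x ->
    exists! p : {n : nat & (cell S n * 'rV[R]_n)%type},
      open_disc (projT2 p).2 /\ chr (projT2 p).1 (projT2 p).2 = x;
  cell_topology : forall F : set T, F `<=` A ->
    (forall n (c : cell S n), closed (@disc n `&` chr c @^-1` F)) ->
    exists2 G : set T, closed G & F = A `&` G
}.

Definition homeo_onto (T U : topologicalType) (A : set T) (B : set U)
    (f : T -> U) : Prop :=
  [/\ {within A, continuous f}, f @` A = B
    & exists2 g : U -> T, {within B, continuous g} &
        forall x, A x -> g (f x) = x].

Definition combinatorial_map (T U : topologicalType) (A : set T)
    (S : cell_structure T) (S' : cell_structure U) (f : T -> U) : Prop :=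
  {within A, continuous f} /\
  forall n (c : cell S n), exists d : cell S' n,
    homeo_onto (open_cell c) (open_cell d) f.

(* The attaching map of each cell is combinatorial for some combinatorial
   structure, of dimension at most n, on the boundary sphere S^n. *)
Inductive combinatorial (T : topologicalType) (A : set T)
    (S : cell_structure T) : Prop :=
  Combinatorial of cw_structure A S &
    (forall n (c : cell S n.+1), exists S' : cell_structure 'rV[R]_n.+1,
      [/\ combinatorial (@sphere n.+1) S',
          forall m, (n < m)%N -> cell S' m -> False
        & combinatorial_map (@sphere n.+1) S' S (chr c)]).

Definition point0 : 'rV[R]_0 := 0.
Definition point1 (t : R) : 'rV[R]_1 := const_mx t.
Definition circle (t : R) : 'rV[R]_2 :=
  \row_(j < 2) (if j == ord0 then cos t else sin t).

(* The attaching map of the 2-cell f, read counterclockwise from some angle,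
   runs homeomorphically and in order through the 1-cells of p, along their
   orientation (from -1 to 1) or against it. *)
Definition attaching_path (T : topologicalType) (S : cell_structure T)
    (f : cell S 2) (p : seq (cell S 1 * bool)) : Prop :=
  exists theta : nat -> R,
    theta (size p) = theta 0%N + 2 * pi /\
    forall i (e : cell S 1) (b : bool) (s : seq (cell S 1 * bool)),
      drop i p = (e, b) :: s ->
      theta i < theta i.+1 /\
      exists h : R -> R,
        [/\ {within `[theta i, theta i.+1], continuous h},
            {in `[theta i, theta i.+1] &, injective h},
            h (theta i) = (-1) ^+ b, h (theta i.+1) = - (-1) ^+ b
          & {in `[theta i, theta i.+1], forall t,
               chr f (circle t) = chr e (point1 (h t))}].

(* The characteristic maps fix the orientations of the cells.  The base points
   of the boundary paths are arbitrary. *)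
Record cell_complex := CellComplex {
  space :> topologicalType;
  cells :> cell_structure space;
  cells_combinatorial : combinatorial [set: space] cells;
  esrc : cell cells 1 -> cell cells 0;
  etgt : cell cells 1 -> cell cells 0;
  esrcP : forall e, chr e (point1 (-1)) = chr (esrc e) point0;
  etgtP : forall e, chr e (point1 1) = chr (etgt e) point0;
  boundary_path : cell cells 2 -> seq (cell cells 1 * bool);
  boundary_path_closed :
    forall f, @closed_path (Graph esrc etgt) (boundary_path f);
  boundary_pathP : forall f, attaching_path f (boundary_path f)
}.

Definition skeleton1 (X : cell_complex) : graph := Graph (@esrc X) (@etgt X).

Definition cell_adjacent (X : cell_complex) (e : cell X 1) (f : cell X 2) :=
  e \in map fst (boundary_path f).

Definition path_connected (T : topologicalType) :=
  forall x y : T, exists f : R -> T,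
    [/\ {within `[0, 1], continuous f}, f 0 = x & f 1 = y].

Definition null_homotopic (T : topologicalType) (f : R -> T) :=
  exists H : R * R -> T,
    [/\ {within `[0, 1] `*` `[0, 1], continuous H},
        {in `[0, 1], forall t, H (t, 0) = f t},
        {in `[0, 1], forall t, H (t, 1) = f 0},
        {in `[0, 1], forall s, H (0, s) = f 0}
      & {in `[0, 1], forall s, H (1, s) = f 0}].

Definition simply_connected (T : topologicalType) :=
  path_connected T /\
  forall f : R -> T, {within `[0, 1], continuous f} -> f 0 = f 1 ->
    null_homotopic f.

(** * Cellular chains and homological Dehn functions *)

Section Chains.
Variable X : cell_complex.
Variable K : numDomainType.

Definition chain i := {freeg (cell X i) / K}.

Definition l1norm i (c : chain i) : K := \sum_(x <- dom c) `|coeff x c|.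

Definition boundary1 : chain 1 -> chain 0 :=
  fglift (fun e => << etgt e >> - << esrc e >>).

Definition boundary2 : chain 2 -> chain 1 :=
  fglift (fun f => \sum_(d <- boundary_path f)
    (if d.2 then << d.1 >> else - << d.1 >>)).

End Chains.

Definition extend_scalars (X : cell_complex) (K : numDomainType) i
    (c : chain X int i) : chain X K i :=
  \sum_(x <- dom c) << (coeff x c)%:~R *g x >>.

(* iota is the inclusion of the coefficient ring K into the reals. *)
Definition filling_norm (X : cell_complex) (K : numDomainType) (iota : K -> R)
    (gamma : chain X int 1) : \bar R :=
  ereal_inf [set (iota (l1norm mu))%:E | mu in
    [set mu : chain X K 2 | boundary2 mu = extend_scalars K gamma]].

Definition FV (X : cell_complex) (K : numDomainType) (iota : K -> R) (k : nat) :
    \bar R :=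
  ereal_sup [set filling_norm iota gamma | gamma in
    [set gamma : chain X int 1 | boundary1 gamma = 0 /\ l1norm gamma <= k%:R]].

Definition FV_Z (X : cell_complex) := FV X (intr : int -> R).
Definition FV_Q (X : cell_complex) := FV X (ratr : rat -> R).

End Complexes.

(* Main.v *)
Require Import Defs.
From HB Require Import structures.
From mathcomp Require Import all_boot all_order all_algebra finmap.
From mathcomp Require Import all_classical all_reals all_analysis.
Import Order.TTheory GRing.Theory Num.Theory.
Import numFieldNormedType.Exports.
Local Open Scope classical_set_scope.
Local Open Scope ring_scope.

Set Implicit Arguments.
Unset Strict Implicit.
Unset Printing Implicit Defensive.

(** A circuit through an edge [e] stays close to [e], where closeness is
   measured by passing from an edge to a 2-cell having it on its boundary and
   from a 2-cell to the edges of its boundary.  Let [reach e n] be the finite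
   set of edges at distance at most [n] from [e], and let the layer [n] consist
   of the 2-cells adjacent to an edge of [reach e n] but to no edge of
   [reach e m] for [m < n].

   Let [p] be a circuit through [e] of length at most [L], and let [mu] be a
   2-chain filling it.  If [p] leaves [S := reach e n], the part of [p] that
   lies in [S] has a free endpoint: some vertex [v] has coefficient 1 in its
   boundary ([coeff_boundary1_restrict_circuit]).  Now cut [mu] along [S], by
   keeping only the 2-cells adjacent to an edge of [S].  The boundary of this
   piece agrees with [p] on [S], and outside [S] it comes from the layer [n]
   only, since the 2-cells of the earlier layers have all their edges in [S].
   As a boundary is a cycle, the part outside [S] must cancel the coefficient 1
   at [v], so the boundary of the layer [n] of [mu] has norm at least 1/2
   ([crossing_layer]).  This forces a definite amount [delta] of mass of [mu]
   into the layer: one can take [delta = 1] for integral chains, and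
   [delta = 1 / (2 M + 2)] for rational ones if the boundary paths have length
   at most [M].

   The layers are disjoint, so a circuit that leaves [reach e N] needs a filling
   of norm at least [N * delta] ([filling_reaches]).  A finite value of the
   homological Dehn function at [L] bounds the norm of a suitable filling, hence
   bounds [N] in terms of [L] alone, and there are only finitely many paths of
   length at most [L] in the finite set [reach e N] ([fine_of_finite_FV]).

   The norm of a rational chain does not bound the number of its 2-cells, so
   over the rationals one cannot argue that a filling has few 2-cells; the layer
   estimate replaces this count. *)

(** * Linear maps on free modules *)

Section LinearExtension.
Variables (K : nzRingType) (I : choiceType).

Lemma fgliftE (M : lmodType K) (f : I -> M) (c : {freeg I / K}) :
  fglift f c = \sum_(x <- dom c) coeff x c *: f x.
Proof. by rewrite -{1}[c]Freeg_dom fglift_Freeg /prelift big_map. Qed.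

Lemma fglift_linear (M : lmodType K) (f : I -> M) : linear (fglift f).
Proof.
move=> a c d; have liftB := lift_is_additive f.
have lift0 : fglift f 0 = 0 by rewrite -[LHS](congr1 _ (subrr 0)) liftB subrr.
have liftN x : fglift f (- x) = - fglift f x by rewrite -[- x]sub0r liftB lift0 sub0r.
have liftD x y : fglift f (x + y) = fglift f x + fglift f y.
  by rewrite -{1}[y]opprK liftB liftN opprK.
rewrite liftD; congr (_ + _).
elim/freeg_ind_dom0: c => [|k x c _ _ IHc]; first by rewrite scaler0 lift0 scaler0.
rewrite scalerDr !liftD scalerDr IHc; congr (_ + _).
have -> : a *: << k *g x >> = << a * k *g x >> :> {freeg I / K}.
  by apply/eqP/freeg_eqP => y; rewrite coeffZ !coeffU mulrA.
by rewrite !liftU scalerA.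
Qed.

HB.instance Definition _ (M : lmodType K) (f : I -> M) :=
  GRing.isLinear.Build K {freeg I / K} M *:%R (fglift f) (fglift_linear f).

Lemma fglift1 (M : lmodType K) (f : I -> M) (x : I) : fglift f << x >> = f x.
Proof. by rewrite liftU scale1r. Qed.

Lemma eq_fglift (M : lmodType K) (f g : I -> M) : f =1 g -> fglift f =1 fglift g.
Proof. by move=> fg c; rewrite !fgliftE; apply: eq_bigr => x _; rewrite fg. Qed.

Definition restrict (P : pred I) : {freeg I / K} -> {freeg I / K} :=
  fglift (fun x => if P x then << x >> else 0).

HB.instance Definition _ P := GRing.Linear.on (restrict P).

Lemma restrictU P x : restrict P << x >> = if P x then << x >> else 0.
Proof. exact: fglift1. Qed.

Lemma coeff_restrict P x c :
  coeff x (restrict P c) = if P x then coeff x c else 0.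
Proof.
elim/freeg_ind_dom0: c => [|k y c _ _ IHc].
  by rewrite linear0 coeff0 if_same.
rewrite linearD !coeffD IHc /= /restrict liftU coeffZ coeffU.
have [->|ne_yx] := eqVneq y x.
  by case: ifP => _; rewrite ?coeffU ?coeff0 ?eqxx ?mulr0 ?addr0 // !mulr1.
rewrite mulr0 add0r; case: (P y); rewrite ?coeffU ?coeff0 ?(negbTE ne_yx) ?mulr0 //;
  by rewrite add0r.
Qed.

End LinearExtension.

Lemma fglift_comp (K : nzRingType) (I J : choiceType) (M : lmodType K)
    (f : I -> {freeg J / K}) (g : J -> M) c :
  fglift g (fglift f c) = fglift (fun x => fglift g (f x)) c.
Proof.
rewrite [fglift f c]fgliftE linear_sum fgliftE; apply: eq_bigr => x _.
by rewrite linearZ.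
Qed.

(** * The l1-norm *)

Section Norm.
Variables (R : realType) (X : cell_complex R) (K : numDomainType) (i : nat).
Implicit Types c d : chain X K i.

Lemma l1norm_on c (s : seq (cell X i)) : uniq s -> {subset dom c <= s} ->
  l1norm c = \sum_(x <- s) `|coeff x c|.
Proof.
move=> s_uniq dom_s; rewrite /l1norm [RHS](bigID [in dom c]) /=.
rewrite [X in _ + X]big1 => [|x /coeff_outdom ->]; last by rewrite normr0.
rewrite addr0 -[RHS]big_filter; apply: perm_big.
apply: uniq_perm; rewrite ?filter_uniq ?uniq_dom // => x.
by rewrite mem_filter; case: (boolP (x \in dom c)) => // /dom_s ->.
Qed.

Lemma l1norm0 : l1norm (0 : chain X K i) = 0.
Proof. by rewrite /l1norm dom0 big_nil. Qed.

Lemma l1norm_ge0 c : 0 <= l1norm c.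
Proof. exact: sumr_ge0. Qed.

Lemma l1normD c d : l1norm (c + d) <= l1norm c + l1norm d.
Proof.
pose s := undup (dom c ++ dom d).
have sub e : {subset e <= dom c ++ dom d} -> {subset e <= s}.
  by move=> es x /es; rewrite mem_undup.
rewrite !(@l1norm_on _ s) ?undup_uniq //; last 3 first.
- by apply: sub => x xd; rewrite mem_cat xd orbT.
- by apply: sub => x xc; rewrite mem_cat xc.
- exact/sub/domD_subset.
by rewrite -big_split /=; apply: ler_sum => x _; rewrite coeffD ler_normD.
Qed.

Lemma l1normZ a c : l1norm (a *: c) = `|a| * l1norm c.
Proof.
rewrite (@l1norm_on _ (dom c)) ?uniq_dom //; last exact: domZ_subset.
by rewrite mulr_sumr; apply: eq_bigr => x _; rewrite coeffZ normrM.
Qed.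

Lemma l1normN c : l1norm (- c) = l1norm c.
Proof. by rewrite -scaleN1r l1normZ normrN1 mul1r. Qed.

Lemma l1norm1 (x : cell X i) : l1norm (<< x >> : chain X K i) = 1.
Proof. by rewrite /l1norm domU1 big_seq1 coeffU eqxx mulr1 normr1. Qed.

Lemma l1norm_sum (T : Type) (s : seq T) (F : T -> chain X K i) :
  l1norm (\sum_(t <- s) F t) <= \sum_(t <- s) l1norm (F t).
Proof.
elim: s => [|t s IHs]; first by rewrite !big_nil l1norm0.
by rewrite !big_cons (le_trans (l1normD _ _)) // lerD2l.
Qed.

Lemma ler_coeff_l1norm x c : `|coeff x c| <= l1norm c.
Proof.
have [xc|/coeff_outdom ->] := boolP (x \in dom c); last by rewrite normr0 l1norm_ge0.
by rewrite /l1norm (bigD1_seq x) ?uniq_dom //= lerDl sumr_ge0.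
Qed.

Lemma l1norm_restrict P c :
  l1norm (restrict P c) = \sum_(x <- dom c | P x) `|coeff x c|.
Proof.
rewrite (@l1norm_on _ (dom c)) ?uniq_dom //; last first.
  by move=> x; rewrite !mem_dom coeff_restrict; case: ifP; rewrite ?eqxx.
rewrite [RHS]big_mkcond; apply: eq_bigr => x _; rewrite coeff_restrict.
by case: ifP; rewrite ?normr0.
Qed.

Lemma l1norm_restrict_le P c : l1norm (restrict P c) <= l1norm c.
Proof.
rewrite l1norm_restrict /l1norm [leRHS](bigID P) /= lerDl.
exact: sumr_ge0.
Qed.

Lemma l1norm_restrictD (P Q : pred (cell X i)) c : subpred P Q ->
  l1norm (restrict Q c) =
  l1norm (restrict P c) + l1norm (restrict (predD Q P) c).
Proof.
move=> PQ; rewrite !l1norm_restrict [LHS](bigID P) /=; congr (_ + _).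
  by apply: eq_bigl => x; apply/andb_idl/PQ.
by apply: eq_bigl => x; rewrite andbC.
Qed.

End Norm.

Lemma l1norm_fglift (R : realType) (X : cell_complex R) (K : numDomainType)
    (i j : nat) (f : cell X i -> chain X K j) (B : K) (c : chain X K i) :
  (forall x, l1norm (f x) <= B) -> l1norm (fglift f c) <= l1norm c * B.
Proof.
move=> fB; rewrite fgliftE (le_trans (l1norm_sum _ _)) //.
rewrite /l1norm mulr_suml; apply: ler_sum => x _.
by rewrite -/(l1norm _) l1normZ ler_wpM2l.
Qed.

(** * Paths and their chains *)

Lemma uniq_map_in_inj (T U : eqType) (f : T -> U) (s : seq T) :
  uniq (map f s) -> {in s &, injective f}.
Proof.
move=> fs_uniq x y xs ys fxy.
rewrite -(nth_index x xs) -(nth_index x ys); congr nth; apply/eqP.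
rewrite -(nth_uniq (f x) _ _ fs_uniq) ?size_map ?index_mem //.
by rewrite !(nth_map x) ?index_mem // !nth_index // fxy.
Qed.

Section PathChains.
Variables (R : realType) (X : cell_complex R) (K : numDomainType).
Local Notation G := (skeleton1 X).
Implicit Types (d : dart G) (p : seq (dart G)).

Definition path_chain p : chain X K 1 :=
  \sum_(d <- p) (if d.2 then << d.1 >> else - << d.1 >>).

Lemma boundary1_path_chain p :
  boundary1 (path_chain p) = \sum_(d <- p) (<< dend d >> - << dstart d >>).
Proof.
rewrite /boundary1 linear_sum; apply: eq_bigr => -[e []] _ /=.
  exact: fglift1.
by rewrite linearN /= fglift1 opprB.
Qed.

Lemma map_dend_closed p :
  closed_path p -> map (@dend G) p = rot 1 (map (@dstart G) p).
Proof.
case: p => // d p /andP[_ /=]; rewrite rot1_cons -map_rcons.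
elim: p {1 3}d => [|d2 p IHp] d1 /=; first by rewrite andbT => /eqP ->.
by case/andP => /eqP -> /IHp ->.
Qed.

(** The endpoints of the darts of a closed path are a rotation of their starting
   points, so the boundary telescopes. *)
Lemma boundary1_closed_path p : closed_path p -> boundary1 (path_chain p) = 0.
Proof.
move=> p_closed; rewrite boundary1_path_chain big_split sumrN /=.
rewrite -(big_map (@dend G) xpredT (fun v => << v >>)).
rewrite -(big_map (@dstart G) xpredT (fun v => << v >>)).
rewrite map_dend_closed // (perm_big (map (@dstart G) p)) ?subrr //.
by rewrite perm_rot.
Qed.

Lemma boundary1_boundary2 (mu : chain X K 2) : boundary1 (boundary2 mu) = 0.
Proof.
rewrite /boundary1 /boundary2 fglift_comp fgliftE big1 // => f _.
rewrite -/(boundary1 (path_chain (boundary_path f))).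
by rewrite boundary1_closed_path ?scaler0 //; exact: boundary_path_closed.
Qed.

Lemma restrict_path_chain (S : pred (cell X 1)) p :
  restrict S (path_chain p) = path_chain [seq d <- p | S d.1].
Proof.
rewrite /path_chain big_filter linear_sum [RHS]big_mkcond /=.
apply: eq_bigr => -[e []] _ /=; rewrite ?linearN /= restrictU;
  by case: ifP; rewrite ?oppr0.
Qed.

Lemma l1norm_path_chain p : l1norm (path_chain p) <= (size p)%:R.
Proof.
rewrite (le_trans (l1norm_sum _ _)) // -sum1_size natr_sum ler_sum // => d _.
by case: d.2; rewrite ?l1normN l1norm1.
Qed.

(** Follow the circuit from [d0] inside [S] to [d1] outside: at some dart [d] it
   leaves [S].  Since the circuit is simple, [d] is its only dart that ends at
   the endpoint of [d], and the only one that starts there is the next dart,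
   which lies outside [S]. *)
Lemma coeff_boundary1_restrict_circuit (S : pred (cell X 1)) p d0 d1 :
  circuit p -> d0 \in p -> d1 \in p -> S d0.1 -> ~~ S d1.1 ->
  exists v, coeff v (boundary1 (restrict S (path_chain p))) = 1.
Proof.
case/and3P => p_closed start_uniq _ d0p d1p Sd0 Sd1.
have p_uniq : uniq p by exact: map_uniq start_uniq.
have end_uniq : uniq (map (@dend G) p) by rewrite map_dend_closed // rot_uniq.
have start_inj := uniq_map_in_inj start_uniq.
have end_inj := uniq_map_in_inj end_uniq.
have [d [dp Sd Snd]] : exists d, [/\ d \in p, S d.1 & ~~ S (next p d).1].
  apply: contrapT => no_exit.
  (* Without an exit membership in [S] propagates along the cycle, and by
     transitivity from [d0] to [d1]. *)
  pose e := [rel d d' : dart G | S d.1 ==> S d'.1].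
  have e_trans : transitive e.
    by move=> y x z /= /implyP xy /implyP yz; apply/implyP => /xy /yz.
  have : cycle e p.
    apply: cycle_from_next => // d dp /=; apply/implyP => Sd.
    by apply: contrapT => /negP Snd; apply: no_exit; exists d.
  rewrite cycle_all2rel // => /allrelP /(_ _ _ d0p d1p) /=.
  by rewrite Sd0 (negbTE Sd1).
have d_next : dend d = dstart (next p d).
  by case/andP: p_closed => _ /(next_cycle) /(_ dp) /eqP.
exists (dend d).
rewrite restrict_path_chain boundary1_path_chain big_split sumrN /=.
rewrite coeffD coeffN !raddf_sum /=.
rewrite (bigD1_seq d) ?filter_uniq ?mem_filter ?Sd //= coeffU eqxx mulr1.
rewrite !big1_seq ?addr0 ?subr0 // => d'; rewrite mem_filter.
  move=> /andP[_ /andP[Sd' d'p]]; rewrite coeffU mul1r d_next.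
  case: eqP => [eq_start|_]; last by rewrite oppr0.
  by move: Snd; rewrite -(start_inj _ _ d'p _ eq_start) ?mem_next // Sd'.
move=> /andP[ne_d'd /andP[_ d'p]]; rewrite coeffU mul1r.
by case: eqP => // /(end_inj _ _ d'p dp) d'd; rewrite d'd eqxx in ne_d'd.
Qed.

Lemma l1norm_boundary1 (c : chain X K 1) : l1norm (boundary1 c) <= l1norm c *+ 2.
Proof.
rewrite -mulr_natr; apply: l1norm_fglift => e.
by rewrite (le_trans (l1normD _ _)) // l1normN !l1norm1 lexx.
Qed.

Lemma l1norm_boundary2 (M : nat) (mu : chain X K 2) :
  (forall f : cell X 2, size (boundary_path f) <= M)%N ->
  l1norm (boundary2 mu) <= l1norm mu * M%:R.
Proof.
move=> sizeM; apply: l1norm_fglift => f.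
by rewrite (le_trans (l1norm_path_chain _)) // ler_nat.
Qed.

Lemma restrict_split (S : pred (cell X 1)) (c : chain X K 1) :
  c = restrict S c + restrict (predC S) c.
Proof.
apply/eqP/freeg_eqP => x; rewrite coeffD !coeff_restrict /=.
by case: (S x); rewrite ?addr0 ?add0r.
Qed.

(** The 2-cells without edges in [S] do not contribute to the boundary there. *)
Lemma eq_restrict_boundary2 (S : pred (cell X 1)) (P Q : pred (cell X 2)) mu :
  (forall f, P f != Q f -> forall d, d \in boundary_path f -> ~~ S d.1) ->
  restrict S (boundary2 (restrict P mu : chain X K 2)) =
  restrict S (boundary2 (restrict Q mu)).
Proof.
move=> PQ; rewrite /boundary2 /restrict !fglift_comp.
apply: eq_fglift => f; have [->|/PQ nS] := eqVneq (P f) (Q f); first by [].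
have vanish : restrict S (path_chain (boundary_path f)) = 0.
  rewrite restrict_path_chain (eq_in_filter (a2 := pred0)) ?filter_pred0.
    exact: big_nil.
  by move=> d /nS /negbTE.
by case: (P f) (Q f) => -[]; rewrite ?linear0 ?fglift1.
Qed.

End PathChains.

(** * Cutting a filling into layers *)

(** Only [predD Q P] contributes to the part outside [S] of the boundary of the
   [Q]-part of [mu], because the 2-cells of [P] have all their edges in [S]; the
   part inside [S] is that of [boundary2 mu].  The two parts sum to a cycle, so a
   coefficient 1 in the boundary of the second has to be compensated by the
   first, and [boundary1] at most doubles the norm. *)
Lemma crossing_layer (R : realType) (X : cell_complex R) (K : numDomainType)
    (S : pred (cell X 1)) (P Q : pred (cell X 2)) (mu : chain X K 2) v :
  subpred P Q ->
  (forall f, P f -> forall d, d \in boundary_path f -> S d.1) ->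
  (forall f, ~~ Q f -> forall d, d \in boundary_path f -> ~~ S d.1) ->
  coeff v (boundary1 (restrict S (boundary2 mu))) = 1 ->
  1 <= l1norm (boundary2 (restrict (predD Q P) mu)) *+ 2.
Proof.
move=> PQ SP SQ coeff_v.
pose muQ := restrict Q mu; pose nu := restrict (predD Q P) mu.
have inside : restrict S (boundary2 muQ) = restrict S (boundary2 mu).
  have mu_all : restrict xpredT mu = mu.
    by apply/eqP/freeg_eqP => f; rewrite coeff_restrict.
  rewrite -[in RHS]mu_all; apply: eq_restrict_boundary2 => f Qf.
  by apply: SQ; case: (Q f) Qf.
have outside :
    restrict (predC S) (boundary2 muQ) = restrict (predC S) (boundary2 nu).
  apply: eq_restrict_boundary2 => f /= QPf d df /=.
  by rewrite negbK (SP f) //; move: QPf; case: (P f) (PQ f) => //= _; rewrite eqxx.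
have bdry : coeff v (boundary1 (restrict (predC S) (boundary2 nu))) = - 1.
  apply/eqP; rewrite -addr_eq0 -coeff_v -coeffD -inside -outside addrC.
  rewrite /boundary1 -linearD -restrict_split.
  by rewrite /= -/(boundary1 _) boundary1_boundary2 coeff0.
have <- : `|coeff v (boundary1 (restrict (predC S) (boundary2 nu)))| = 1 :> K.
  by rewrite bdry normrN1.
rewrite (le_trans (ler_coeff_l1norm _ _)) // (le_trans (l1norm_boundary1 _)) //.
by rewrite lerMn2r l1norm_restrict_le.
Qed.

Section Reach.
Variables (R : realType) (X : cell_complex R) (e : cell X 1).

(** The disjunction inlines [reach n'], so that [reach] can be defined from
   [reach_faces] without a mutual recursion. *)
Fixpoint reach_faces n : set (cell X 2) :=
  if n is n'.+1 then
    [set f | exists2 a,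
       a = e \/ (exists2 f', reach_faces n' f' & cell_adjacent a f') &
       cell_adjacent a f]
  else set0.

Definition reach n : set (cell X 1) :=
  [set a | a = e \/ exists2 f, reach_faces n f & cell_adjacent a f].

Lemma reach_facesS n :
  reach_faces n.+1 = [set f | exists2 a, reach n a & cell_adjacent a f].
Proof. by []. Qed.

Lemma sub_reach_faces n : reach_faces n `<=` reach_faces n.+1.
Proof.
elim: n => // n IHn f [a [ae|[f' f'n af']] af]; exists a => //.
  by left.
by right; exists f' => //; apply: IHn.
Qed.

Lemma sub_reach n : reach n `<=` reach n.+1.
Proof.
move=> a [->|[f fn af]]; first by left.
by right; exists f => //; apply: sub_reach_faces.
Qed.

Lemma finite_reach n :
  (forall a : cell X 1, finite_set [set f : cell X 2 | cell_adjacent a f]) ->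
  finite_set (reach n).
Proof.
move=> Xfin.
have fin_faces A : finite_set A ->
    finite_set [set a : cell X 1 | exists2 f : cell X 2, A f & cell_adjacent a f].
  pose edges (f : cell X 2) := [set` map fst (boundary_path f)].
  move=> finA; apply: (@sub_finite_set _ _ (\bigcup_(f in A) edges f)).
    by move=> a [f Af af]; exists f.
  by apply: bigcup_finite => // f _; exact: finite_seq.
have reachE m :
    reach m = [set e] `|` [set a | exists2 f, reach_faces m f & cell_adjacent a f].
  by apply/seteqP; split => a.
rewrite reachE finite_setU; split => //; apply/fin_faces.
elim: n => [|n IHn]; first exact: finite_set0.
pose faces (a : cell X 1) := [set f : cell X 2 | cell_adjacent a f].
rewrite reach_facesS; apply: (@sub_finite_set _ _ (\bigcup_(a in reach n) faces a)).
  by move=> f [a an af]; exists a.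
apply: bigcup_finite => [|a _]; last exact: Xfin.
by rewrite reachE finite_setU; split => //; apply/fin_faces.
Qed.

End Reach.

(** [crossing_layer] applies at each of the [n] distances that the circuit
   crosses, and the hypothesis on [delta] turns the boundary found there into
   mass of the filling.  These masses add up because the layers are disjoint. *)
Lemma filling_reaches (R : realType) (X : cell_complex R) (K : numDomainType)
    (delta : K) (e : cell X 1) (p : seq (dart (skeleton1 X))) (mu : chain X K 2) n a :
  (forall nu : chain X K 2, 1 <= l1norm (boundary2 nu) *+ 2 -> delta <= l1norm nu) ->
  circuit p -> e \in map fst p -> boundary2 mu = path_chain K p ->
  a \in map fst p -> ~ reach e n a ->
  delta *+ n <= l1norm mu.
Proof.
move=> delta_le p_circuit ep mu_fill ap.
pose F m : pred (cell X 2) := fun f => `[< reach_faces e m f >].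
suff: ~ reach e n a -> delta *+ n <= l1norm (restrict (F n) mu).
  by move=> H /H /le_trans; apply; exact: l1norm_restrict_le.
elim: n => [|n IHn] an; first by rewrite mulr0n l1norm_ge0.
have {}an : ~ reach e n a by move=> /sub_reach.
pose S : pred (cell X 1) := fun b => `[< reach e n b >].
case/mapP: ep => d0 d0p ed0; case/mapP: ap => d1 d1p ad1.
have [||v coeff_v] :=
  @coeff_boundary1_restrict_circuit _ _ K S p d0 d1 p_circuit d0p d1p.
- by apply/asboolP; rewrite -ed0; left.
- by apply/asboolPn; rewrite -ad1.
have FS : subpred (F n) (F n.+1).
  by move=> f /asboolP fn; apply/asboolP/sub_reach_faces.
rewrite (l1norm_restrictD _ FS) mulrSr lerD ?IHn //.
apply: delta_le; apply: (@crossing_layer _ _ _ S _ _ _ v) => //.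
- move=> f /asboolP fn d df; apply/asboolP; right; exists f => //.
  exact: map_f.
- move=> f /asboolPn fn d df; apply/asboolPn => Sd; apply: fn.
  rewrite reach_facesS; exists d.1 => //; exact: map_f.
by rewrite mu_fill.
Qed.

(** * Fine graphs from finite Dehn functions *)

Lemma finite_bounded_seqs (T : choiceType) (A : set T) n : finite_set A ->
  finite_set [set s : seq T | (forall x, x \in s -> A x) /\ (size s <= n)%N].
Proof.
move=> finA; elim: n => [|n IHn].
  apply: (@sub_finite_set _ _ [set [::]]) => // s [_].
  by rewrite leqn0 size_eq0 => /eqP.
pose B := [set s : seq T | (forall x, x \in s -> A x) /\ (size s <= n)%N].
pose C := (fun xs => xs.1 :: xs.2) @` (A `*` B).
apply: (@sub_finite_set _ _ ([set [::]] `|` C)).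
  move=> [|x s] [sA sn]; first by left.
  right; exists (x, s) => //; split => /=; first by apply: sA; rewrite mem_head.
  by split => // y ys; apply: sA; rewrite inE ys orbT.
rewrite finite_setU; split => //; apply: finite_image; exact: finite_setX.
Qed.

Lemma extend_path_chain (R : realType) (X : cell_complex R) (K : numDomainType)
    (p : seq (dart (skeleton1 X))) :
  extend_scalars K (path_chain int p) = path_chain K p.
Proof.
have coeff_extend (c : chain X int 1) x :
    coeff x (extend_scalars K c) = (coeff x c)%:~R.
  rewrite -[in RHS](freeg_sumE c) !raddf_sum /=; apply: eq_bigr => y _.
  by rewrite !coeffU rmorphM /= mulrz_nat.
apply/eqP/freeg_eqP => x; rewrite coeff_extend !raddf_sum /=.
apply: eq_bigr => -[y []] _ /=; rewrite ?coeffN !coeffU !mul1r ?rmorphN /= ?mulrNz;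
  by rewrite mulrz_nat.
Qed.

Lemma FV_bound (R : realType) (X : cell_complex R) (K : numDomainType)
    (iota : K -> R) (k : nat) : (FV X iota k < +oo)%E ->
  exists B : R, forall gamma : chain X int 1,
    boundary1 gamma = 0 -> l1norm gamma <= k%:R ->
    exists2 mu : chain X K 2,
      boundary2 mu = extend_scalars K gamma & iota (l1norm mu) < B.
Proof.
move=> FVk; have [B FVB] : exists B : R, (FV X iota k < B%:E)%E.
  case: (FV X iota k) FVk => [r _|//|_]; last by exists 0; rewrite ltNyr.
  by exists (r + 1); rewrite lte_fin ltrDl.
exists B => gamma gamma_cycle gamma_k.
have : (filling_norm iota gamma < B%:E)%E.
  by apply: le_lt_trans FVB; apply: ereal_sup_ubound; exists gamma.
case/ereal_inf_lt => _ [mu mu_fill <-]; rewrite lte_fin => mu_B.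
by exists mu.
Qed.

(** Both coefficient rings are treated at once: they differ only in the reason
   why a 2-chain whose boundary has norm at least 1/2 has norm at least
   [delta]. *)
Lemma fine_of_finite_FV (R : realType) (X : cell_complex R) (K : numDomainType)
    (iota : {rmorphism K -> R}) (delta : K) :
  {mono iota : x y / x <= y} ->
  0 < delta ->
  (forall nu : chain X K 2, 1 <= l1norm (boundary2 nu) *+ 2 -> delta <= l1norm nu) ->
  (forall a : cell X 1, finite_set [set f : cell X 2 | cell_adjacent a f]) ->
  (forall k : nat, (FV X iota k < +oo)%E) ->
  fine_graph (skeleton1 X).
Proof.
move=> iota_mono delta_gt0 delta_le Xfin FVfin e L _.
have [B fill] := FV_bound (FVfin L).
have idelta : 0 < iota delta.
  by rewrite -(rmorph0 iota) (leW_mono iota_mono).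
have [N B_le] : exists N : nat, B <= iota delta *+ N.
  exists (Num.bound `|B / iota delta|).
  rewrite -mulr_natr -ler_pdivrMl // mulrC ltW //.
  by rewrite (le_lt_trans (ler_norm _)) // archi_boundP.
pose near_darts : set (dart (skeleton1 X)) := reach e N `*` setT.
have fin_near : finite_set near_darts.
  by apply: finite_setX; [exact: finite_reach | exact: finite_finset].
apply: (sub_finite_set _ (finite_bounded_seqs L fin_near)).
move=> p [p_circuit ep pL]; split => // d dp; split => //.
apply: contrapT => d_far.
have [||mu mu_fill mu_B] := fill (path_chain int p).
- by apply: boundary1_closed_path; case/and3P: p_circuit.
- by rewrite (le_trans (l1norm_path_chain _ _)) // ler_nat.
have : delta *+ N <= l1norm mu.
  apply: (filling_reaches delta_le p_circuit ep _ _ d_far); last exact: map_f.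
  by rewrite mu_fill extend_path_chain.
rewrite -iota_mono rmorphMn /= => /(le_trans B_le).
by rewrite leNgt mu_B.
Qed.

Unset Implicit Arguments.

Theorem theorem1p6 (R : realType) (X : cell_complex R)
    (Xfin : forall e : cell X 1, finite_set [set f : cell X 2 | cell_adjacent e f])
    (hX : (forall k : nat, (FV_Z X k < +oo)%E) \/
          [/\ simply_connected R X,
              exists M : nat, forall f : cell X 2,
                (size (boundary_path f) <= M)%N
            & exists2 C : R, 0 <= C &
                forall k : nat, (FV_Q X k <= (C * k%:R)%:E)%E]) :
  fine_graph (skeleton1 X).
Proof.
case: hX => [FVfin|[_ [M sizeM] [C _ FV_linear]]].
  (* A nonzero integral chain has norm at least 1. *)
  apply: (@fine_of_finite_FV R X int intr 1) => //; first exact: ler_int.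
  move=> nu bdry_nu; rewrite -gtz0_ge1 lt_def l1norm_ge0 andbT.
  apply: contraTneq bdry_nu => nu0.
  have -> : nu = 0.
    apply/eqP/freeg_eqP => f; rewrite coeff0; apply/eqP.
    by rewrite -normr_le0 -nu0 ler_coeff_l1norm.
  by rewrite /boundary2 linear0 l1norm0.
(* [M.+1] rather than [M], so that [delta] makes sense also for [M = 0]. *)
have M2_gt0 : 0 < (M.+1 * 2)%:R :> rat by rewrite ltr0n muln_gt0.
apply: (@fine_of_finite_FV R X rat ratr (M.+1 * 2)%:R^-1) => //.
- exact: ler_rat.
- move=> nu bdry_nu; rewrite -div1r ler_pdivrMr // natrM mulrA mulr_natr.
  rewrite (le_trans bdry_nu) // lerMn2r /=.
  apply: l1norm_boundary2 => f; exact: leq_trans (sizeM f) _.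
by move=> k; apply: le_lt_trans (FV_linear k) (ltry _).
Qed.
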